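(* The cone $\mathbf{S}^3_+$ of real symmetric $3\times 3$ positive semidefinite matrices does not admit a $\mathcal{Q}^k$-lift for any finite $k$. That is, for every positive integer $k$ there exist no linear subspace $L \subseteq \mathbb{R}^{3k}$ and linear map $\pi$ from $\mathbb{R}^{3k}$ to the ($6$-dimensional) real vector space of real symmetric $3\times 3$ matrices such that $\mathbf{S}^3_+ = \pi(\mathcal{Q}^k \cap L)$.
   Context: $\mathcal{Q} = \{(x,t) \in \mathbb{R}^2\times\mathbb{R} : \|x\| \le t\} \subset \mathbb{R}^3$ is the three-dimensional second-order cone ($\|\cdot\|$ is the Euclidean norm), and $\mathcal{Q}^k = \mathcal{Q}\times\dots\times\mathcal{Q}$ ($k$ copies) $\subset \mathbb{R}^{3k}$. A convex cone $K \subset \mathbb{R}^m$ has a $\mathcal{Q}^k$-lift (second-order cone lift of size $k$) if $K = \pi(\mathcal{Q}^k \cap L)$ for some linear map $\pi:\mathbb{R}^{3k}\to\mathbb{R}^m$ and some linear subspace $L$ of $\mathbb{R}^{3k}$. *)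

(* Defs.v *)
From HB Require Import structures.
From mathcomp Require Import all_boot all_order all_algebra.
From mathcomp Require Import classical_sets reals.

Set Implicit Arguments.
Unset Strict Implicit.
Unset Printing Implicit Defensive.

Import Order.TTheory GRing.Theory Num.Theory.
Local Open Scope classical_set_scope.
Local Open Scope ring_scope.

(* The norm that MathComp-Analysis puts on 'rV[R]_n is the sup norm. *)
Definition enorm (R : realType) (n : nat) (x : 'rV[R]_n) : R :=
  Num.sqrt (\sum_i x 0 i ^+ 2).

Definition soc (R : realType) : set 'rV[R]_(2 + 1) :=
  [set v | enorm (lsubmx v) <= rsubmx v 0 0].

(* [vec_mx] cuts a vector of length 3k into k consecutive blocks of length 3. *)
Definition socpow (R : realType) (k : nat) : set 'rV[R]_(k * 3) :=
  [set v | forall i : 'I_k, soc (row i (vec_mx v))].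

Definition has_soc_lift (R : realType) (k : nat) (V : vectType R) (K : set V) :
    Prop :=
  exists (L : {vspace 'rV[R]_(k * 3)}) (pi : {linear 'rV[R]_(k * 3) -> V}),
    K = pi @` (@socpow R k `&` [set v | v \in L]).

Definition symv (R : realType) (n : nat) : {vspace 'M[R]_n} :=
  fixedSpace (linfun (@trmx R n n)).

Lemma mem_symv (R : realType) (n : nat) (A : 'M[R]_n) :
  (A \in symv R n) = (A^T == A).
Proof. by apply/fixedSpaceP/eqP; rewrite lfunE. Qed.

(* The type [subvs_of (symv R n)] is the space of symmetric n x n matrices. *)
Definition psd_cone (R : realType) (n : nat) : set (subvs_of (symv R n)) :=
  [set A | forall x : 'cV[R]_n, 0 <= (x^T *m vsval A *m x) 0 0].
Arguments psd_cone : clear implicits.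

(* Main.v *)
(** If a cone lift exists, pick [z_i] in [Q^k] and in [L] above the rank one
    matrix [v_i v_i^T] with [v_i = (1, i, i^2)].  Given enough indices, the
    pigeonhole principle yields distinct [i], [j], [l] such that in every block
    [z_i], [z_j], [z_l] are either all zero, or nonzero on one common ray, or
    nonzero on three distinct rays.  In the first two cases [z_l] is dominated
    by a multiple of [z_i + z_j]; in the last one [z_i + z_j] is interior to
    [Q], so this holds too.  Hence [C (z_i + z_j) - z_l] lies in [Q^k] and in
    [L] for some [C >= 0], and [C (v_i v_i^T + v_j v_j^T) - v_l v_l^T] is
    positive semidefinite.  This fails on the cross product of [v_i] and [v_j],
    which is not orthogonal to [v_l]. *)
Require Import Defs.
From mathcomp Require Import all_boot all_order all_algebra.
From mathcomp Require Import classical_sets reals.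
From mathcomp Require Import ring lra.
Import boot.fintype boot.finset.

Set Implicit Arguments.
Unset Strict Implicit.
Unset Printing Implicit Defensive.

Import Order.TTheory GRing.Theory Num.Theory.
Local Open Scope ring_scope.

(** * Common large subsets for finitely many maps *)

Section Pigeonhole.
Variables (I : finType) (T : eqType).

Definition constant_or_injective_on (B : {set I}) (f : I -> T) :=
  {in B &, forall i j, f i = f j} \/ {in B &, injective f}.

Lemma constant_or_injective_onS (B C : {set I}) (f : I -> T) :
  C \subset B -> constant_or_injective_on B f -> constant_or_injective_on C f.
Proof.
by move=> /subsetP sCB [] h; [left|right] => i j /sCB iB /sCB jB; apply: h.
Qed.

(** Split [A] into the fibres of [f]. If no fibre has more than [m] elements, there are more than
    [m] fibres, and [f] is injective on a transversal. *)
Lemma large_constant_or_injective_on (f : I -> T) (A : {set I}) (m : nat) :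
  (m * m < #|A|)%N ->
  exists B : {set I},
    [/\ B \subset A, (m < #|B|)%N & constant_or_injective_on B f].
Proof.
move=> ltA; have partP := preim_partitionP f A.
set P := preim_partition f A in partP.
have eqvR : {in A & &, equivalence_rel (fun x y => f x == f y)}.
  by split=> // /eqP->.
have fE x y : x \in A -> y \in A -> (pblock P x == pblock P y) = (f x == f y).
  move=> xA yA; have /and3P[/eqP covP tiP _] := partP.
  by rewrite eq_pblock ?covP // pblock_equivalence_partition.
have /and3P[/eqP covP tiP _] := partP.
have [/exists_inP[B BP ltB]|/exists_inPn noB] :=
    boolP [exists B in P, (m < #|B|)%N].
  have sBA : B \subset A by rewrite -covP; apply: bigcup_sup.
  exists B; split=> //; left=> i j iB jB; apply/eqP.
  by rewrite -fE ?(subsetP sBA) // !(def_pblock tiP BP).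
have trX := transversalP partP; exists (transversal P A); split.
- exact: transversal_sub trX.
- rewrite (card_transversal trX) ltnNge; apply/negP => leP.
  move: ltA; rewrite ltnNge (card_partition partP) => /negP; apply.
  apply: leq_trans (_ : \sum_(B in P) m <= _)%N.
    by apply: leq_sum => B /noB; rewrite -leqNgt.
  by rewrite sum_nat_const leq_mul2r leP orbT.
- have /subsetP sXA := transversal_sub trX.
  right=> i j iX jX fij; apply: (pblock_inj trX) => //; apply/eqP.
  by rewrite fE ?sXA ?fij.
Qed.

(** Each map costs one square root of the bound, as 2^2^(n+1) is the square of 2^2^n; the bound 2 is
    left at the end. *)
Lemma large_all_constant_or_injective_on (J : eqType) (f : J -> I -> T)
    (s : seq J) (A : {set I}) :
  (2 ^ 2 ^ size s < #|A|)%N ->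
  exists B : {set I}, [/\ B \subset A, (2 < #|B|)%N &
    forall j, j \in s -> constant_or_injective_on B (f j)].
Proof.
elim: s A => [|j s IHs] A /= ltA; first by exists A; split.
have [|B [sBA ltB fB]] :=
    @large_constant_or_injective_on (f j) A (2 ^ 2 ^ size s).
  by rewrite -expnD addnn -mul2n -expnS.
have [C [sCB ltC fC]] := IHs _ ltB.
exists C; split=> //; first exact: subset_trans sBA.
move=> l; rewrite inE => /orP[/eqP->|]; last exact: fC.
exact: constant_or_injective_onS fB.
Qed.

End Pigeonhole.

(** * Domination in the second-order cone and its powers *)

Section SecondOrderCone.
Variable R : realType.
Implicit Types (a b t p q r c : R) (u v w : 'rV[R]_(2 + 1)).

Lemma socP v :
  soc v <-> v 0 0 ^+ 2 + v 0 1 ^+ 2 <= v 0 2%:R ^+ 2 /\ 0 <= v 0 2%:R.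
Proof.
rewrite /soc /enorm /= big_ord_recl big_ord1 !mxE.
have -> : lshift 1 (0 : 'I_2) = 0 by apply/val_inj.
have -> : lshift 1 (lift 0 (0 : 'I_1)) = 1 by apply/val_inj.
have -> : rshift 2 (0 : 'I_1) = 2%:R by apply/val_inj.
have sq0 : 0 <= v 0 0 ^+ 2 + v 0 1 ^+ 2 by rewrite addr_ge0 ?sqr_ge0.
split=> [le_t|[le_sq t0]].
  have t0 := le_trans (sqrtr_ge0 _) le_t; split=> //.
  by rewrite -(sqr_sqrtr sq0) ler_sqr ?nnegrE ?sqrtr_ge0.
by rewrite -ler_sqr ?nnegrE ?sqrtr_ge0 // sqr_sqrtr.
Qed.

(** Cauchy-Schwarz, by the Lagrange identity with the square of [a * q - b * p]. *)
Lemma soc_dot_le a b t p q r :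
  a ^+ 2 + b ^+ 2 <= t ^+ 2 -> 0 <= t -> p ^+ 2 + q ^+ 2 <= r ^+ 2 -> 0 <= r ->
  a * p + b * q <= t * r.
Proof.
move=> hu t0 hv r0.
have [neg|pos] := leP (a * p + b * q) 0; first by rewrite (le_trans neg) ?mulr_ge0.
rewrite -ler_sqr ?nnegrE ?mulr_ge0 ?(ltW pos) // exprMn.
apply: le_trans (_ : (a ^+ 2 + b ^+ 2) * (p ^+ 2 + q ^+ 2) <= _).
  have := sqr_ge0 (a * q - b * p); lra.
by apply: ler_pM => //; rewrite addr_ge0 ?sqr_ge0.
Qed.

Lemma socD u v : soc u -> soc v -> soc (u + v).
Proof.
move=> /socP[hu t0] /socP[hv r0]; apply/socP; rewrite !mxE.
split; last exact: addr_ge0.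
have := soc_dot_le hu t0 hv r0; lra.
Qed.

Lemma socZ c u : 0 <= c -> soc u -> soc (c *: u).
Proof.
move=> c0 /socP[hu t0]; apply/socP; rewrite !mxE; split; last exact: mulr_ge0.
by rewrite !exprMn -mulrDr ler_wpM2l ?sqr_ge0.
Qed.

(** Equality case of Cauchy-Schwarz: if the strict inequality fails, the product of the last
    coordinates t of [u] and r of [v] is at most the dot product of the planar parts, which forces r
    u = t v. *)
Lemma soc_interiorD u v : soc u -> soc v -> 0 < u 0 2%:R -> 0 < v 0 2%:R ->
  (u 0 2%:R)^-1 *: u != (v 0 2%:R)^-1 *: v ->
  (u + v) 0 0 ^+ 2 + (u + v) 0 1 ^+ 2 < (u + v) 0 2%:R ^+ 2.
Proof.
move=> /socP[hu _] /socP[hv _] t0 r0; rewrite ltNge; apply: contra => le_uv.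
set t := u 0 2%:R in hu t0 le_uv *; set r := v 0 2%:R in hv r0 le_uv *.
have t_neq0 : t != 0 by rewrite gt_eqF.
have r_neq0 : r != 0 by rewrite gt_eqF.
have eq0 : (u 0 0 * r - v 0 0 * t) ^+ 2 + (u 0 1 * r - v 0 1 * t) ^+ 2 <= 0.
  have h1 : r ^+ 2 * (u 0 0 ^+ 2 + u 0 1 ^+ 2) <= r ^+ 2 * t ^+ 2.
    by rewrite ler_wpM2l ?sqr_ge0.
  have h2 : t ^+ 2 * (v 0 0 ^+ 2 + v 0 1 ^+ 2) <= t ^+ 2 * r ^+ 2.
    by rewrite ler_wpM2l ?sqr_ge0.
  have h3 : t * r <= u 0 0 * v 0 0 + u 0 1 * v 0 1.
    move: le_uv; rewrite !mxE -/t -/r; lra.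
  have h4 : (t * r) * (t * r) <= (t * r) * (u 0 0 * v 0 0 + u 0 1 * v 0 1).
    by rewrite ler_wpM2l // mulr_ge0 // ltW.
  lra.
have sq0 := sqr_ge0 (u 0 0 * r - v 0 0 * t).
have sq1 := sqr_ge0 (u 0 1 * r - v 0 1 * t).
have e0 : u 0 0 * r - v 0 0 * t = 0 by apply/eqP; rewrite -sqrf_eq0; apply/eqP; lra.
have e1 : u 0 1 * r - v 0 1 * t = 0 by apply/eqP; rewrite -sqrf_eq0; apply/eqP; lra.
apply/eqP/rowP => i; rewrite !mxE.
have cross : u 0 i * r = v 0 i * t.
  case: i => -[|[|[|//]]] hi.
  - by rewrite (_ : Ordinal hi = 0); [lra|apply/val_inj].
  - by rewrite (_ : Ordinal hi = 1); [lra|apply/val_inj].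
  - by rewrite (_ : Ordinal hi = 2%:R); [rewrite mulrC|apply/val_inj].
apply: (mulIf t_neq0); apply: (mulIf r_neq0).
rewrite [t^-1 * _]mulrC divfK // cross; field.
exact: r_neq0.
Qed.

(** The hypotheses say that [w] lies in the face of [Q] generated by [u + v]. *)
Lemma soc_dominated u v w : soc u -> soc v -> soc w ->
  (u 0 2%:R == 0) = (w 0 2%:R == 0) -> (u 0 2%:R == 0) = (v 0 2%:R == 0) ->
  (u 0 2%:R)^-1 *: u = (w 0 2%:R)^-1 *: w \/
    (u 0 2%:R)^-1 *: u != (v 0 2%:R)^-1 *: v ->
  exists2 c, 0 <= c & soc (c *: (u + v) - w).
Proof.
move=> su sv sw zuw zuv huvw.
have [/socP[hu t0] /socP[hv r0] /socP[hw s0]] := And3 su sv sw.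
have [tz|t_neq0] := eqVneq (u 0 2%:R) 0.
  have wz : w 0 2%:R = 0 by apply/eqP; rewrite -zuw tz.
  (* With last coordinate 0, [- w] satisfies the same inequalities as [w]. *)
  exists 0 => //; rewrite scale0r sub0r; apply/socP.
  by rewrite !mxE !sqrrN wz oppr0; split=> //; rewrite -[in leRHS]wz.
have r_neq0 : v 0 2%:R != 0 by rewrite -zuv.
have s_neq0 : w 0 2%:R != 0 by rewrite -zuw.
have tgt0 : 0 < u 0 2%:R by rewrite lt_def t_neq0.
have rgt0 : 0 < v 0 2%:R by rewrite lt_def r_neq0.
case: huvw => [par|npar].
  have c0 : 0 <= w 0 2%:R / u 0 2%:R by rewrite divr_ge0.
  exists (w 0 2%:R / u 0 2%:R) => //.
  rewrite scalerDr -[X in soc (X + _ - _)]scalerA par scalerA divff // scale1r.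
  by rewrite addrAC subrr add0r; apply: socZ.
have lt_uv := soc_interiorD su sv tgt0 rgt0 npar.
have /socP[_] := socD su sv.
move: (u + v) lt_uv => x lt_x x0.
set D := x 0 2%:R ^+ 2 - (x 0 0 ^+ 2 + x 0 1 ^+ 2).
have D0 : 0 < D by rewrite subr_gt0.
have D_neq0 : D != 0 by rewrite gt_eqF.
(* Write q for the quadratic form of the cone, so q(x) = [D]. Then q(c x - w) is at least c (c [D] -
   4 x_2 w_2), because q(w) >= 0 and x_2 w_2 bounds the planar dot product of x and -w. This [c]
   makes the lower bound zero. *)
pose c := 4 * (x 0 2%:R * w 0 2%:R) / D.
have cD : c * D = 4 * (x 0 2%:R * w 0 2%:R) by rewrite divfK.
have c0 : 0 <= c by rewrite divr_ge0 ?(ltW D0) // !mulr_ge0.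
exists c => //; apply/socP; rewrite !mxE; split.
  have dot : x 0 0 * - w 0 0 + x 0 1 * - w 0 1 <= x 0 2%:R * w 0 2%:R.
    by apply: soc_dot_le => //; rewrite ?sqrrN // ltW.
  have := ler_wpM2l c0 dot.
  have : c * (c * D) = c * (4 * (x 0 2%:R * w 0 2%:R)) by rewrite cD.
  rewrite /D; lra.
rewrite subr_ge0 -(ler_pM2r D0) mulrAC cD.
have leD : D <= x 0 2%:R ^+ 2 by rewrite gerBl addr_ge0 ?sqr_ge0.
have := ler_wpM2l s0 leD.
have := mulr_ge0 s0 (sqr_ge0 (x 0 2%:R)); lra.
Qed.

Lemma row_vec_mx_comb (k : nat) (m : 'I_k) c (x y z : 'rV[R]_(k * 3)) :
  row m (vec_mx (c *: (x + y) - z)) =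
  c *: (row m (vec_mx x) + row m (vec_mx y)) - row m (vec_mx z).
Proof. by apply/rowP => i; rewrite !mxE. Qed.

Lemma socpow_dominated (k : nat) (x y z : 'rV[R]_(k * 3)) :
  socpow x -> socpow y ->
  (forall m : 'I_k, exists2 c, 0 <= c &
     soc (c *: (row m (vec_mx x) + row m (vec_mx y)) - row m (vec_mx z))) ->
  exists c, socpow (c *: (x + y) - z).
Proof.
(* The sum of the blockwise constants serves every block: its surplus over [c m] only adds an
   element of the cone. *)
move=> sx sy /fin_all_exists2[c c0 sc]; exists (\sum_m c m) => m.
rewrite row_vec_mx_comb (bigD1 m) //= scalerDl addrAC.
by apply: socD => //; apply: socZ; [apply: sumr_ge0|apply: socD].
Qed.

End SecondOrderCone.

(** * Rank-one matrices on the moment curve *)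

Section RankOne.
Variable R : realType.
Implicit Types (a b c : R) (x v : 'cV[R]_3).

Definition moment a : 'cV[R]_3 := \col_i a ^+ i.

(** The cross product of [moment a] and [moment b], divided by [b - a]. *)
Definition moment_normal a b : 'cV[R]_3 :=
  \col_i [:: a * b; - (a + b); 1]`_i.

Lemma moment_normalE a b c :
  ((moment_normal a b)^T *m moment c) 0 0 = (c - a) * (c - b).
Proof. by rewrite !mxE !big_ord_recl big_ord0 !mxE /=; ring. Qed.

Lemma rank1_in_symv v : v *m v^T \in symv R 3.
Proof. by rewrite mem_symv trmx_mul trmxK. Qed.

Definition rank1 v : subvs_of (symv R 3) := Subvs (rank1_in_symv v).

Lemma rank1_form v x : (x^T *m (v *m v^T) *m x) 0 0 = (x^T *m v) 0 0 ^+ 2.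
Proof.
rewrite mulmxA -mulmxA mxE big_ord1 expr2; congr (_ * _).
by rewrite -[v^T *m x]trmxK trmx_mul trmxK mxE.
Qed.

Lemma rank1_psd v : psd_cone R 3 (rank1 v).
Proof. by move=> x /=; rewrite rank1_form sqr_ge0. Qed.

(** At [moment_normal a b] the terms of [a] and [b] vanish, which leaves minus the square of (c -
    a)(c - b), whatever [d] is. *)
Lemma moment_not_dominated a b c d : c != a -> c != b ->
  ~ psd_cone R 3 (d *: (rank1 (moment a) + rank1 (moment b)) - rank1 (moment c)).
Proof.
move=> ca cb /(_ (moment_normal a b)).
rewrite linearB linearZ linearD /= mulmxBl -scalemxAl mulmxDl.
have -> (A B C : 'M[R]_1) : (d *: (A + B) - C) 0 0 = d * (A 0 0 + B 0 0) - C 0 0.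
  by rewrite !mxE.
rewrite !rank1_form !moment_normalE !subrr mul0r mulr0 expr0n /= addr0 mulr0.
rewrite sub0r oppr_ge0 leNgt lt_def sqr_ge0 sqrf_eq0 mulf_eq0 !subr_eq0.
by rewrite (negPf ca) (negPf cb).
Qed.

End RankOne.

Theorem theorem1 (R : realType) (k : nat) (hk : (0 < k)%N) :
  ~ has_soc_lift k (psd_cone R 3).
Proof.
case=> L [pi liftE].
pose J : finType := ('I_k * bool)%type.
pose I := 'I_(2 ^ 2 ^ size (enum J)).+1.
pose v (i : I) := moment (i%:R : R).
have /fin_all_exists[z zP] (i : I) : exists x, [/\ socpow x, x \in L & pi x = rank1 (v i)].
  have : psd_cone R 3 (rank1 (v i)) by exact: rank1_psd.
  by rewrite liftE => -[x [sx xL] xE]; exists x.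
pose blk i m : 'rV[R]_3 := row m (vec_mx (z i)).
(* Two maps per block: the ray, normalised to last coordinate 1, and whether the last coordinate
   vanishes. The latter is coded as a constant row to share the codomain. *)
pose f (j : J) i : 'rV[R]_3 :=
  if j.2 then (blk i j.1 0 2%:R)^-1 *: blk i j.1
  else const_mx (blk i j.1 0 2%:R == 0)%:R.
have [|B [_ ltB fB]] := @large_all_constant_or_injective_on _ _ _ f (enum J) [set: I].
  by rewrite cardsT card_ord.
have {}fB j : constant_or_injective_on B (f j) by apply: fB; rewrite mem_enum.
have /card_gt2P[i [j [l [[iB jB lB] [ij jl li]]]]] := ltB.
(* A two-valued map cannot be injective on three indices, so it is constant on [B]. *)
have zero_const m (a b : I) : a \in B -> b \in B ->
    (blk a m 0 2%:R == 0) = (blk b m 0 2%:R == 0).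
  have inj_eq (c d : bool) :
      const_mx c%:R = const_mx d%:R :> 'rV[R]_3 -> c = d.
    by move=> /rowP/(_ 0)/eqP; rewrite !mxE eqr_nat; case: c d => -[].
  move=> aB bB; case: (fB (m, false)) => [cst|inj].
    exact: inj_eq (cst a b aB bB).
  have nE (c d : I) : c \in B -> d \in B -> c != d ->
      (blk c m 0 2%:R == 0) != (blk d m 0 2%:R == 0).
    move=> cB dB; apply: contra => /eqP e; apply/eqP/inj => //.
    by rewrite /f /= e.
  have := nE _ _ iB jB ij; have := nE _ _ jB lB jl; have := nE _ _ lB iB li.
  by case: (blk i m 0 _ == 0); case: (blk j m 0 _ == 0); case: (blk l m 0 _ == 0).
have [si iL iE] := zP i; have [sj jL jE] := zP j; have [sl lL lE] := zP l.
have [m|c sc] := @socpow_dominated R k (z i) (z j) (z l) si sj.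
  apply: soc_dominated (si m) (sj m) (sl m) _ _ _; try exact: zero_const.
  case: (fB (m, true)) => [cst|inj]; [left; exact: cst|right].
  by apply: contra ij => /eqP /inj->.
have : psd_cone R 3 (pi (c *: (z i + z j) - z l)).
  by rewrite liftE; exists (c *: (z i + z j) - z l) => //; split=> //=;
     rewrite rpredB // rpredZ // rpredD.
rewrite linearB linearZ linearD /= iE jE lE.
by apply: moment_not_dominated; rewrite eqr_nat // eq_sym.
Qed.
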